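(* Let $L$ be a compactly generated multiplicative lattice with $1$ compact, satisfying the max-bounded property. Then the lower space $\mathrm{Prop}(L)$ of proper elements of $L$ is a spectral space.
   Context: A multiplicative lattice is a complete lattice $(L,\leqslant,0,1)$ with a binary operation $\cdot$ that is associative, commutative, satisfies $x\cdot 1=x$, and satisfies $x\cdot\bigvee_{\lambda\in\Lambda}y_\lambda=\bigvee_{\lambda\in\Lambda}(x\cdot y_\lambda)$ for all $x\in L$ and all families $(y_\lambda)_{\lambda\in\Lambda}$ in $L$. An element $c$ is compact if $c\leqslant\bigvee_{\lambda\in\Lambda}x_\lambda$ implies $c\leqslant\bigvee_{i=1}^n x_{\lambda_i}$ for some finite subfamily; $L$ is compactly generated if every element of $L$ is a join of compact elements. An element $x$ is proper if $x\neq 1$; $\mathrm{Prop}(L)$ is the set of proper elements. A proper $m$ is maximal if $m\leqslant n$ and $n\neq 1$ imply $m=n$. $L$ satisfies the max-bounded property if for every proper $x\in L$ there is a maximal element $m$ with $x\leqslant m$. For $x\in L$ put $v(x)=\{l\in\mathrm{Prop}(L)\mid x\leqslant l\}$. The lower space $\mathrm{Prop}(L)$ is the set $\mathrm{Prop}(L)$ with the topology for which $\{v(x)\mid x\in L\}$ is a subbasis of closed sets. A topological space is spectral if it is compact (every open cover has a finite subcover), sober (every non-empty irreducible closed subset is the closure of a unique point), and admits a basis of compact open subspaces that is closed under finite intersections. *)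

(* Defs.v *)
From HB Require Import structures.
From mathcomp Require Export all_boot all_order.
From mathcomp Require Export boolp classical_sets functions cardinality.
From mathcomp Require Export topology.

Set Implicit Arguments.
Unset Strict Implicit.
Unset Printing Implicit Defensive.
Import Order.TTheory.

Local Open Scope classical_set_scope.
Local Open Scope order_scope.

HB.mixin Record Lattice_isComplete d T & Order.TBLattice d T := {
  csup : set T -> T;
  cinf : set T -> T;
  csupP : forall A : set T, supremums A (csup A);
  cinfP : forall A : set T, infimums A (cinf A);
}.

#[short(type="completeLatticeType")]
HB.structure Definition CompleteLattice d :=
  {T of Order.TBLattice d T & Lattice_isComplete d T}.

(* The join of a family (y_i) is written as the csup of its set of values;
   A = set0 is allowed, so in particular lmul x \bot = \bot. *)
HB.mixin Record CompleteLattice_isMultiplicative d T & CompleteLattice d T := {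
  lmul : T -> T -> T;
  lmulA : associative lmul;
  lmulC : commutative lmul;
  lmulx1 : right_id (\top : T) lmul;
  lmul_csup : forall (x : T) (A : set T),
    lmul x (csup A) = csup [set lmul x y | y in A];
}.

#[short(type="multLatticeType")]
HB.structure Definition MultLattice d :=
  {T of CompleteLattice d T & CompleteLattice_isMultiplicative d T}.

Section LatticeNotions.
Context {d : Order.disp_t} (L : completeLatticeType d).

Definition compact_elt : set L := [set c | forall A : set L,
  c <= csup A -> exists B : set L, [/\ finite_set B, B `<=` A & c <= csup B]].

Definition compactly_generated :=
  forall x : L, exists2 A : set L, A `<=` compact_elt & x = csup A.

Definition proper_elt (x : L) : bool := x != \top.

Definition maximal_elt (m : L) :=
  proper_elt m /\ forall n : L, m <= n -> n != \top -> m = n.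

Definition max_bounded :=
  forall x : L, proper_elt x -> exists2 m : L, maximal_elt m & x <= m.

Definition properSpace := {x : L | proper_elt x}.

HB.instance Definition _ := Choice.on properSpace.

Definition vset (x : L) : set properSpace := [set l | x <= val l].

(* The open subbasis consists of the complements of the sets vset x, indexed by
   themselves. *)
HB.instance Definition _ := @isSubBaseTopological.Build properSpace
  (set properSpace) [set ~` vset x | x in [set: L]] id.

End LatticeNotions.

Definition irreducible_set (T : topologicalType) (A : set T) :=
  forall F G : set T, closed F -> closed G ->
    A `<=` F `|` G -> A `<=` F \/ A `<=` G.

Definition sober_space (T : topologicalType) :=
  forall A : set T, A !=set0 -> irreducible_set A -> closed A ->
    exists! x : T, A = closure [set x].

(* finI_from B id is the set of all intersections of finite subsets of B,
   including the empty one, whose intersection is setT. *)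
Definition spectral_space (T : topologicalType) :=
  [/\ cover_compact [set: T],
      sober_space T
    & exists B : set (set T),
        [/\ basis B, B `<=` @cover_compact T & finI_from B id `<=` B]].

(* Main.v *)
(* The closed sets of the form [vset c] with [c] compact already generate the
   topology, since [vset (csup C)] is the intersection of the [vset c] for [c]
   in [C].  An ultrafilter [F] converges to the join [l] of all [x] such that
   [vset x] belongs to [F]: for [c] compact, [c <= l] forces [vset c] to belong
   to [F], so [l] is proper because [1] is compact, and [l] avoids [vset c]
   whenever [F] does.  This gives compactness of the finite intersections of
   the complements of the [vset c].  An irreducible closed set [A] equals
   [vset m], the closure of [m], where [m] is the join of all [x] such that
   [vset x] contains [A]. *)
From mathcomp Require Import finmap.
Require Import Defs.

Set Implicit Arguments.
Unset Strict Implicit.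
Unset Printing Implicit Defensive.
Import Order.TTheory.

Local Open Scope order_scope.
Local Open Scope classical_set_scope.

(* The library's [compact_cover] is restricted to pointed spaces, whereas
   [properSpace L] is empty when [L] is trivial. *)
Lemma compact_cover_compact (T : topologicalType) (A : set T) :
  compact A -> cover_compact A.
Proof.
move=> cA I D f fop fcov; apply: contrapT => nfin.
(* Without a finite subcover, the parts of [A] missed by finite subfamilies generate a proper
   filter. It has a cluster point in [A], yet no [f i] can contain one. *)
pose subD := [set E : {fset I} | {subset E <= D}].
pose rest (E : {fset I}) := A `\` cover [set` E] f.
have FF : Filter (filter_from subD rest).
  apply: filter_from_filter; first by exists fset0.
  move=> E1 E2 sE1 sE2; exists (E1 `|` E2)%fset.
    by move=> i; rewrite inE => /orP[/sE1|/sE2].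
  move=> p [Ap nE]; split; split=> // -[i Ei fip]; apply: nE; exists i => //;
    by rewrite /= inE Ei ?orbT.
have PF : ProperFilter (filter_from subD rest).
  apply: filter_from_proper => E sE; apply/set0P/eqP => E0; apply: nfin.
  exists E => // p Ap; apply: contrapT => nEp.
  by have : set0 p by rewrite -E0.
have FA : filter_from subD rest A by exists fset0 => // p [].
have [p [Ap clp]] := cA _ PF FA.
have [i Di fip] := fcov p Ap.
have Ffi : filter_from subD rest (rest [fset i]%fset).
  by exists [fset i]%fset => // j /fset1P ->; rewrite inE.
have [q [[_ nq] fiq]] := clp _ (f i) Ffi (open_nbhs_nbhs (conj (fop i Di) fip)).
by apply: nq; exists i => //=; rewrite inE.
Qed.

Lemma finI_from_finI (I : choiceType) (T : Type) (D : set I) (f : I -> set T) :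
  finI_from (finI_from D f) id `<=` finI_from D f.
Proof.
move=> _ [E sE <-]; rewrite bigcap_fset big_seq.
apply: (big_ind (finI_from D f)).
- by exists fset0 => //; rewrite predeqE => t; split.
- by move=> U V; exact: finI_fromI.
- by move=> U /sE; rewrite inE.
Qed.

Section CompleteLattice.
Context {d : Order.disp_t} (L : completeLatticeType d).
Implicit Types (x c : L) (C : set L).

Lemma csup_ub C x : C x -> x <= csup C.
Proof. by have [ub _] := csupP C; exact: ub. Qed.

Lemma csup_le C x : (forall y, C y -> y <= x) -> csup C <= x.
Proof. by have [_ lb] := csupP C => ub; apply: lb. Qed.

End CompleteLattice.

Section LowerSpace.
Context {d : Order.disp_t} (L : completeLatticeType d).
Implicit Types (x c : L) (C : set L) (p q : properSpace L).

Lemma open_setC_vset x : open (~` vset x).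
Proof.
exists [set ~` vset x]; last by rewrite bigcup_set1.
by move=> _ ->; apply: finI_from1; exists x.
Qed.

Lemma closed_vset x : closed (vset x).
Proof. by rewrite -[vset x]setCK; apply/open_closedC/open_setC_vset. Qed.

(** Each neighbourhood of [p] contains a finite intersection of subbasic open sets around [p], and
    filters are stable under finite intersections. *)
Lemma cvg_lower (F : set_system (properSpace L)) p : Filter F ->
  (forall x, ~ x <= val p -> F (~` vset x)) -> F --> p.
Proof.
move=> FF Fp A; rewrite nbhsE => -[U [[D' sD' <-] [V D'V Vp]] UA].
apply: (filterS UA).
have /sD' [E sE EV] := D'V.
apply: (@filterS _ _ _ V); first by move=> q Vq; exists V.
rewrite -EV; apply: filter_bigI => W EW.
have := sE _ EW; rewrite inE => -[x _ xW]; rewrite -xW; apply: Fp => xp.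
by have : W p; [move: Vp; rewrite -EV; apply|rewrite -xW; apply].
Qed.

Lemma closure_lower p : closure [set p] = vset (val p).
Proof.
apply/seteqP; split=> q.
  by rewrite closureE; apply; split=> [|_ ->]; [exact: closed_vset|exact: lexx].
(* The principal filter at [p] converges to [q] exactly when [q] is in the closure of [p]. *)
move=> pq B; apply: (@cvg_lower [set B | ([set p] `&` B) !=set0] q).
  split.
  - by exists p.
  - by move=> U V [_ [->/= Up]] [_ [->/= Vp]]; exists p.
  - by move=> U V UV [_ [->/= Up]]; exists p; split=> //; exact: UV.
move=> x nxq; exists p; split=> // xp; apply: nxq.
exact: le_trans xp pq.
Qed.

Lemma sober_lower : sober_space (properSpace L).
Proof.
move=> A [a Aa] irrA clA.
pose m := csup [set x | A `<=` vset x].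
have mA : A `<=` vset m by move=> p Ap; apply: csup_le => x; exact.
have mprop : proper_elt m.
  apply/negP => /eqP mtop; have := mA _ Aa; rewrite /vset/= mtop le1x.
  exact/negP/(valP a).
pose l : properSpace L := exist _ m mprop.
have Al : A l.
  (* Irreducibility says that the open sets meeting [A] generate a filter. *)
  pose F : set_system (properSpace L) :=
    [set U | exists V, [/\ open V, V `<=` U & A `&` V !=set0]].
  have FF : Filter F.
    split.
    - by exists setT; split; [exact: openT| |exists a].
    - move=> U1 U2 [V1 [oV1 VU1 [p [Ap V1p]]]] [V2 [oV2 VU2 [q [Aq V2q]]]].
      exists (V1 `&` V2); split; [exact: openI|exact: setISS|].
      apply: contrapT => AV0.
      have [||r Ar|AC|AC] := irrA (~` V1) (~` V2).
      + exact: open_closedC.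
      + exact: open_closedC.
      + by rewrite -setCI => Vr; apply: AV0; exists r.
      + exact: AC Ap V1p.
      + exact: AC Aq V2q.
    - move=> U1 U2 U12 [V [oV VU AV]].
      by exists V; split=> //; exact: subset_trans U12.
  have Fl : F --> l.
    apply: cvg_lower => x nxl; exists (~` vset x); split=> //.
      exact: open_setC_vset.
    (* If [A] misses the complement of [vset x], then [x] is one of the elements joined in [m]. *)
    apply: contrapT => AV0; apply: nxl; apply: csup_ub => p Ap.
    by apply: contrapT => nxp; apply: AV0; exists p.
  apply: clA => B /Fl [V [_ VB [p [Ap Vp]]]].
  by exists p; split=> //; exact: VB.
exists l; split.
  rewrite closure_lower; apply/seteqP; split => // p lp.
  move: clA => /closure_id ->; apply: (@closureS _ [set l]); first by move=> _ ->.
  by rewrite closure_lower.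
(* Uniqueness is antisymmetry: [l] and [q] each lie in the closure of the other. *)
move=> q Aq; apply: val_inj; apply/eqP; rewrite eq_le; apply/andP; split.
  by apply: mA; rewrite Aq closure_lower /vset/=.
by move: Al; rewrite Aq closure_lower.
Qed.

Definition coarse_base : set (set (properSpace L)) :=
  finI_from (@compact_elt d L) (fun c => ~` vset c).

Lemma basis_coarse_base : compactly_generated L -> basis coarse_base.
Proof.
move=> cgL; split.
  move=> _ [E _ <-]; rewrite bigcap_fset.
  by apply: big_ind => [|U V|c _]; [exact: openT|exact: openI|exact: open_setC_vset].
move=> p.
(* The basis condition at [p] is convergence of this filter to [p], so [cvg_lower] applies. *)
have FF : Filter (filter_from [set U | coarse_base U /\ U p] id).
  apply: filter_from_filter.
    by exists setT; split=> //; exists fset0 => //; rewrite predeqE => t; split.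
  move=> U V [bU Up] [bV Vp]; exists (U `&` V) => //.
  by split=> //; exact: finI_fromI.
apply: cvg_lower => x nxp; have [C cptC xC] := cgL x.
have [c Cc ncp] : exists2 c, C c & ~ c <= val p.
  apply: contrapT => nC; apply: nxp; rewrite xC; apply: csup_le => c Cc.
  by apply: contrapT => ncp; apply: nC; exists c.
exists (~` vset c).
  by split=> //; apply: (finI_from1 (fun c => ~` vset c)); exact: cptC.
by move=> q ncq xq; apply: ncq; apply: le_trans xq; rewrite xC; exact: csup_ub.
Qed.

Lemma compact_coarse_base :
  compact_elt (\top : L) -> coarse_base `<=` @compact (properSpace L).
Proof.
move=> cpt1 _ [E sE <-]; rewrite compact_ultra => F UF FE.
pose l := csup [set x | F (vset x)].
have Fc c : compact_elt c -> c <= l -> F (vset c).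
  move=> cptc /cptc [B [finB BF cB]].
  have : F (\bigcap_(x in B) vset x).
    move: finB BF => /finite_fsetP [B' ->] BF.
    by apply: filter_bigI => x; exact: BF.
  apply: filterS => p Bp; apply: (le_trans cB); apply: csup_le => x Bx.
  exact: Bp.
have lprop : proper_elt l.
  (* Points are proper, so [vset \top] is empty and cannot belong to [F]. *)
  apply/negP => /eqP ltop.
  have /filter_ex [p /=] : F (vset \top) by apply: Fc => //; rewrite ltop.
  by rewrite /vset/= le1x; exact/negP/(valP p).
exists (exist _ l lprop : properSpace L); split.
  move=> c Ec /= cl; have cptc : compact_elt c by have := sE _ Ec; rewrite inE.
  have /filter_ex [p [cp Ep]] : F (vset c `&` \bigcap_(i in [set` E]) ~` vset i).
    by apply: filterI => //; exact: Fc.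
  exact: Ep Ec cp.
apply: cvg_lower => x nxl.
(* If [F] contains [vset x], then [x] is below [l] by the choice of [l]; otherwise the ultrafilter
   contains the complement. *)
by have [Fx|//] := in_ultra_setVsetC (vset x) UF; case: nxl; exact: csup_ub.
Qed.

End LowerSpace.

Theorem theorem2p16 (d : Order.disp_t) (L : multLatticeType d) :
  compactly_generated L ->
  compact_elt (Order.top : L) ->
  max_bounded L ->
  spectral_space (properSpace L).
Proof.
move=> cgL cpt1 _.
have cptB : coarse_base (L := L) `<=` @cover_compact (properSpace L).
  by move=> U /(compact_coarse_base cpt1); exact: compact_cover_compact.
split; last exists (coarse_base (L := L)).
(* The whole space is the empty intersection, hence a member of the base. *)
- by apply: cptB; exists fset0 => //; rewrite predeqE => t; split.
- exact: sober_lower.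
- by split=> //; [exact: basis_coarse_base|exact: finI_from_finI].
Qed.
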